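(* Let $\mathcal{E}\colon I\to\mathbb{R}$ be the error-sum function of Pierce expansions on $I=[0,1]$, and let $G(I)=\{(x,\mathcal{E}(x)) : x\in I\}\subseteq\mathbb{R}^2$ be its graph, with the subspace topology. Then the covering dimension of the graph is zero: $\dim_{\mathrm{cov}} G(I)=0$.
   Context: Let $I=[0,1]$ and $\mathbb{N}_\infty=\mathbb{N}\cup\{\infty\}$ where $\mathbb{N}=\{1,2,3,\dots\}$, with the conventions $\infty+c=\infty$ and $c/\infty=0$ for $c\in\mathbb{R}$; a product of elements of $\mathbb{N}_\infty$ with a factor $\infty$ equals $\infty$. Define $d_1\colon I\to\mathbb{N}_\infty$ and $T\colon I\to I$ by $d_1(x)=\lfloor 1/x\rfloor$, $T(x)=1-d_1(x)\,x$ for $x\neq 0$, and $d_1(0)=\infty$, $T(0)=0$. For $n\in\mathbb{N}$ let $d_n(x)=d_1(T^{n-1}x)$ (the Pierce expansion digits of $x$), and let $$s_n(x)=\sum_{k=1}^n\frac{(-1)^{k+1}}{d_1(x)\cdots d_k(x)}.$$ The error-sum function of Pierce expansions is $\mathcal{E}\colon I\to\mathbb{R}$, $\mathcal{E}(x)=\sum_{n=1}^\infty (x-s_n(x))$ (the series converges absolutely and uniformly on $I$). For a non-empty topological space $X$, the covering (topological) dimension $\dim_{\mathrm{cov}}X$ is the least integer $m\ge 0$ such that every finite open cover of $X$ has a finite open refinement covering $X$ in which each point of $X$ belongs to at most $m+1$ members ($\infty$ if no such $m$ exists). *)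

(* Defs.v *)
From mathcomp Require Import all_boot all_order all_algebra.
From mathcomp Require Import all_classical all_reals all_analysis.

Set Implicit Arguments.
Unset Strict Implicit.
Unset Printing Implicit Defensive.

Import Order.TTheory GRing.Theory Num.Theory.
Import numFieldNormedType.Exports.

Local Open Scope classical_set_scope.
Local Open Scope ring_scope.

(* N_oo = {1, 2, ...} U {oo} is embedded in \bar R, whose library conventions
   give d * +oo = +oo for d > 0 and (+oo)^-1 = 0.  All functions of the Pierce
   expansion are total on R but meant for arguments in I = [0, 1] only. *)

Definition pierce_d1 {R : realType} (x : R) : \bar R :=
  if x == 0 then +oo%E else (Num.floor x^-1)%:~R%:E.

(* fine is only applied to the finite digit of some x != 0. *)
Definition pierce_T {R : realType} (x : R) : R :=
  if x == 0 then 0 else 1 - fine (pierce_d1 x) * x.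

(* Digits are numbered from 1; index 0 is a junk value. *)
Definition pierce_d {R : realType} (n : nat) (x : R) : \bar R :=
  pierce_d1 (iter n.-1 pierce_T x).

Definition pierce_s {R : realType} (n : nat) (x : R) : R :=
  \sum_(1 <= k < n.+1)
    (-1) ^+ k.+1 * fine ((\prod_(1 <= j < k.+1) pierce_d j x)^-1)%E.

Definition pierce_error_sum {R : realType} (x : R) : R :=
  limn (fun N : nat => \sum_(1 <= n < N.+1) (x - pierce_s n x)).

Definition pierce_error_sum_graph (R : realType) : set (R * R) :=
  [set (x, pierce_error_sum x) | x in `[0, 1]].
Arguments pierce_error_sum_graph : clear implicits.

Definition finite_open_cover {X : topologicalType} (C : set (set X)) : Prop :=
  [/\ finite_set C, C `<=` open & \bigcup_(U in C) U = [set: X]].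

Definition refines {X : Type} (D C : set (set X)) : Prop :=
  forall V, D V -> exists2 U, C U & V `<=` U.

Definition covering_dim_le (X : topologicalType) (m : nat) : Prop :=
  forall C : set (set X), finite_open_cover C ->
  exists D : set (set X), [/\ finite_open_cover D, refines D C &
    forall x : X, ([set V | D V /\ V x] #<= `I_m.+1)%card].

(* Intended for nonempty X: the empty space gets dimension 0 here, not -1. *)
Definition covering_dim (X : topologicalType) : \bar nat :=
  match pselect (exists m, `[< covering_dim_le X m >]) with
  | left ex_m => (ex_minn ex_m)%:E
  | right _ => +oo%E
  end.

(* Main.v *)
Require Import Defs.
From mathcomp Require Import all_boot all_order all_algebra.
From mathcomp Require Import all_classical all_reals all_analysis.
From mathcomp Require Import ring lra.

Import numFieldNormedType.Exports.

(** The graph of the error-sum function E carries a countable base of clopen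
    sets, which gives covering dimension 0.

    Everything rests on the functional equation
      E(x) = - (T x + E(T x)) / d_1(x),
    obtained by shifting the digits in every partial sum ([error_sumE]).  An
    induction along it gives - x <= E(x) <= 0 ([error_sum_itv]).

    The sets {k x <= 1} look merely closed, but E jumps at 1/k: it vanishes
    there, while just to the right of 1/k the functional equation applied
    twice keeps E below a negative constant ([error_sum_jump]).  So on the
    graph, where both x and E(x) vary continuously, {k x <= 1} is clopen
    ([graph_clopen_le_inv]).  On the points of first digit j the map
    (x, E(x)) |-> (T x, E(T x)) is the restriction of an affine map of the
    plane, namely (x, y) |-> (1 - j x, - j y - 1 + j x).  Pulling back along
    these maps makes every cylinder (prescribed first digits w, and next
    digit at least k) clopen in the graph ([graph_clopen_cylinder]).

    For a digit j >= 2 this affine map expands a suitable distance by at least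
    4/3, and only the first digit can be 1; hence deep cylinders are small.
    When the expansion of x stops, the cylinders with the remaining digits
    large are small around x, since |E(y)| <= y.  So the countably many
    cylinders form a base of the graph ([small_cylinder], [cylinder_base]).

    Finally, in a space with a countable clopen base, a cover is refined by
    attaching to each point the least index of a basic set that contains the
    point and lies in a member of the cover; this index is locally constant,
    and grouping its level sets by the chosen member of the cover yields
    disjoint open sets, at most one for each member
    ([countable_clopen_base_covering_dim_le0]). *)

(** * Digits and the shift map *)

Section PierceErrorSum.
Import Order.TTheory GRing.Theory Num.Theory.
Local Open Scope classical_set_scope.
Local Open Scope ring_scope.
Context {R : realType}.
Implicit Types (x y : R) (j k n N : nat).

(* That is, floor(1/x) = j; written without division, so that it is a pair of
   affine conditions on x. *)
Local Notation on_digit j x := (j%:R * x <= 1 < j.+1%:R * x).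

Lemma pierce_d1E j x : on_digit j x ->
  pierce_d1 x = j%:R%:E.
Proof.
move=> /andP[jx xj].
have x0 : 0 < x.
  by rewrite -(pmulr_rgt0 x (ltr0Sn R j)) (lt_trans ltr01 xj).
rewrite /pierce_d1 gt_eqF//; congr (_ %:E).
rewrite (@floor_def R x^-1 j%:Z)// -PoszD addn1.
by rewrite -[x^-1]mul1r ler_pdivlMr// jx /= ltr_pdivrMr.
Qed.

Lemma pierce_TE j x : on_digit j x -> pierce_T x = 1 - j%:R * x.
Proof.
move=> jx; rewrite /pierce_T (pierce_d1E _ _ jx) /=; case: eqP => // x0.
by move: jx; rewrite x0 !mulr0 ltr10 andbF.
Qed.

Lemma digit_exists x : 0 < x <= 1 ->
  exists2 j, (0 < j)%N & on_digit j x.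
Proof.
move=> /andP[x0 x1]; have xV0 : 0 <= x^-1 by rewrite invr_ge0 ltW.
have /andP[j1 j2] := truncn_itv xV0.
rewrite -[x^-1]mul1r in j1 j2 *.
rewrite ler_pdivlMr// in j1; rewrite ltr_pdivrMr// in j2.
exists (Num.truncn (1 * x^-1)); last by rewrite j1.
by rewrite mul1r truncn_gt0 invf_ge1.
Qed.

(** With value 0 at x = 0, the inverse first digit satisfies the identities
    below at every point of [0, 1], without a case distinction. *)
Definition dinv x : R := fine (pierce_d1 x)^-1%E.

Lemma dinv0 : dinv 0 = 0.
Proof. by rewrite /dinv /pierce_d1 eqxx invey. Qed.

Lemma dinvE j x : (0 < j)%N -> on_digit j x ->
  dinv x = j%:R^-1.
Proof.
by move=> j0 jx; rewrite /dinv (pierce_d1E _ _ jx) inver pnatr_eq0 gtn_eqF.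
Qed.

Lemma pierce_T0 : pierce_T 0 = 0 :> R.
Proof. by rewrite /pierce_T eqxx. Qed.

(** Statements about [0, 1] reduce to the point 0, which has no finite digit,
    and to positive points with a known first digit. *)
Lemma digit_case (P : R -> Prop) : P 0 ->
  (forall j x, (0 < j)%N -> 0 < x <= 1 -> on_digit j x -> P x) ->
  forall x, 0 <= x <= 1 -> P x.
Proof.
move=> P0 PS x /andP[]; rewrite le_eqVlt => /predU1P[<-//|x0 x1].
have x01 : 0 < x <= 1 by rewrite x0.
by have [j j0 jx] := digit_exists _ x01; exact: PS jx.
Qed.

(** This is x = (1 - T x) / d_1(x), the first step of the expansion. *)
Lemma mul_dinvT x : 0 <= x <= 1 -> dinv x * pierce_T x = dinv x - x.
Proof.
move: x; apply: digit_case => [|j x j0 x01 jx].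
  by rewrite dinv0 mul0r subrr.
rewrite (dinvE j)// (pierce_TE j)//.
have : (j%:R : R) != 0 by rewrite pnatr_eq0 -lt0n.
by move=> ?; field.
Qed.

(** T x = 1 - j x < 1 / (j + 1) when the first digit is j, so all digits after
    the first are at least 2. *)
Lemma pierce_T_itv x : 0 <= x <= 1 -> 0 <= pierce_T x <= 2^-1.
Proof.
move: x; apply: digit_case => [|j x j0 /andP[x0 x1] jx].
  by rewrite pierce_T0 lexx invr_ge0 ler0n.
rewrite (pierce_TE j)//; move: jx; rewrite -natr1.
have : (1 : R) <= j%:R by rewrite ler1n.
by move=> ? /andP[? ?]; apply/andP; split; nra.
Qed.

Lemma pierce_T_itv1 x : 0 <= x <= 1 -> 0 <= pierce_T x <= 1.
Proof. by move=> /pierce_T_itv /andP[-> ?]; lra. Qed.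

Lemma iter_pierce_T_itv n x : 0 <= x <= 1 -> 0 <= iter n pierce_T x <= 1.
Proof. by move=> x01; elim: n => //= n; exact: pierce_T_itv1. Qed.

Lemma dinv_ge0 x : 0 <= x <= 1 -> 0 <= dinv x.
Proof.
move: x; apply: digit_case => [|j x j0 _ jx]; first by rewrite dinv0.
by rewrite (dinvE j)// invr_ge0.
Qed.

(** 1/j <= 2/(j+1) < 2 x.  This is what keeps x + E(x) nonnegative. *)
Lemma dinv_le_double x : 0 <= x <= 1 -> dinv x <= 2 * x.
Proof.
move: x; apply: digit_case => [|j x j0 x01 jx]; first by rewrite dinv0 mulr0.
have j1 : (1 : R) <= j%:R by rewrite ler1n.
move: x01 jx => /andP[x0 _] jx; rewrite (dinvE j)// -div1r.
rewrite ler_pdivrMr; last by lra.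
by move: jx => /andP[_]; rewrite -natr1; nra.
Qed.

Lemma dinv_mul_le1 k x : 0 <= x <= 1 -> k%:R * x <= 1 -> k%:R * dinv x <= 1.
Proof.
move: x; apply: digit_case => [|j x j0 /andP[x0 _] jx kx].
  by rewrite dinv0 mulr0.
rewrite (dinvE j)// ler_pdivrMr ?ltr0n// mul1r ler_nat -ltnS.
rewrite -(ltr_nat R) -(ltr_pM2r x0).
by move: jx => /andP[_]; apply: le_lt_trans.
Qed.

Lemma dinv_le1 x : 0 <= x <= 1 -> dinv x <= 1.
Proof.
move=> x01; have := dinv_mul_le1 1 _ x01.
by rewrite !mul1r; apply; case/andP: x01.
Qed.

Lemma dinv_le_half x : 0 <= x <= 2^-1 -> dinv x <= 2^-1.
Proof.
move=> x01; have := dinv_mul_le1 2 x.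
by move: x01 => /andP[? ?] H; have := H _ _; lra.
Qed.

Lemma pierce_d1_gt0 x : 0 <= x <= 1 -> (0 < pierce_d1 x)%E.
Proof.
move: x; apply: digit_case => [|j x j0 _ jx].
  by rewrite /pierce_d1 eqxx.
by rewrite (pierce_d1E _ _ jx) lte_fin ltr0n.
Qed.

(** * The functional equation of the error sum *)

(** Products with an infinite factor have inverse 0 on both sides; excluding
    zero factors avoids the inverse of 0, which is infinite. *)
Lemma fine_inveM (a b : \bar R) : (0 < a)%E -> (0 < b)%E ->
  fine (a * b)^-1%E = fine a^-1%E * fine b^-1%E.
Proof.
case: a b => [a||] [b||] //; rewrite ?lte_fin => a0 b0.
- by rewrite -EFinM !inver mulf_eq0 !gt_eqF//= invfM.
- by rewrite gt0_muley ?lte_fin// !invey /= mulr0.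
- by rewrite gt0_mulye ?lte_fin// !invey /= mul0r.
- by rewrite mulyy !invey /= mulr0.
Qed.

Lemma fine_inv_prod_pierce_d n x : 0 <= x <= 1 ->
  fine (\prod_(1 <= j < n.+1) pierce_d j x)^-1%E =
  \prod_(0 <= j < n) dinv (iter j pierce_T x).
Proof.
move=> x01; rewrite big_add1 /=.
suff [] : (0 < \prod_(0 <= i < n) pierce_d i.+1 x)%E /\
  fine (\prod_(0 <= i < n) pierce_d i.+1 x)^-1%E =
  \prod_(0 <= j < n) dinv (iter j pierce_T x) by [].
apply: (big_ind2 (fun (a : \bar R) b => (0 < a)%E /\ fine a^-1%E = b)).
- by rewrite lte01 inve1.
- by move=> a b c d [a0 <-] [c0 <-]; rewrite mule_gt0// fine_inveM.
- by move=> j _; split=> //; apply/pierce_d1_gt0/iter_pierce_T_itv.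
Qed.

Lemma pierce_sS n x : 0 <= x <= 1 ->
  pierce_s n.+1 x = dinv x * (1 - pierce_s n (pierce_T x)).
Proof.
move=> x01; have Tx := pierce_T_itv1 _ x01.
rewrite /pierce_s big_nat_recl// mulrBr mulr1; congr (_ + _).
  by rewrite fine_inv_prod_pierce_d// big_nat1 expr2 mulrNN !mul1r.
rewrite mulr_sumr -sumrN; apply: eq_bigr => k _.
rewrite !fine_inv_prod_pierce_d// big_nat_recl//= exprS mulN1r mulNr.
congr (- _); rewrite mulrCA; congr (_ * (_ * _)).
by apply: eq_bigr => i _; rewrite -iterSr.
Qed.

(** Removing the first digit: the errors of x at step n+1 and of T x at
    step n differ by the factor - 1/d_1(x). *)
Lemma pierce_errS n x : 0 <= x <= 1 ->
  x - pierce_s n.+1 x = - dinv x * (pierce_T x - pierce_s n (pierce_T x)).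
Proof.
by move=> x01; rewrite pierce_sS//; have := mul_dinvT _ x01; lra.
Qed.

Lemma pierce_s0 x : pierce_s 0 x = 0.
Proof. by rewrite /pierce_s big_geq. Qed.

Definition error_psum N x : R := \sum_(1 <= n < N.+1) (x - pierce_s n x).

Lemma error_psumS N x : 0 <= x <= 1 ->
  error_psum N.+1 x = - dinv x * (pierce_T x + error_psum N (pierce_T x)).
Proof.
move=> x01; rewrite /error_psum big_nat_recl// pierce_errS// pierce_s0 subr0.
rewrite [RHS]mulrDr mulr_sumr; congr (_ + _).
by apply: eq_bigr => n _; rewrite pierce_errS.
Qed.

(** If E' is the partial sum at T x and q = 1/d_1(x), the claim for x reads
    0 <= q (T x + E') <= x.  The induction hypothesis gives
    0 <= T x + E' <= T x, and q T x = q - x <= x. *)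
Lemma error_psum_itv N x : 0 <= x <= 1 -> - x <= error_psum N x <= 0.
Proof.
elim: N x => [|N IH] x x01.
  by rewrite /error_psum big_geq// lexx oppr_le0 andbT; case/andP: x01.
rewrite error_psumS//.
have /IH/andP[h1 h2] := pierce_T_itv1 _ x01.
have := mul_dinvT _ x01; have := dinv_le_double _ x01.
have := dinv_ge0 _ x01 => q0 q2 qT.
have : dinv x * error_psum N (pierce_T x) <= 0 by rewrite mulr_ge0_le0.
have : 0 <= dinv x * (pierce_T x + error_psum N (pierce_T x)).
  by rewrite mulr_ge0//; lra.
rewrite mulrDr mulNr => ? ?; apply/andP; split; lra.
Qed.

(** Starting from x <= 1/2 all digits are at least 2, hence the geometric
    rate. *)
Lemma pierce_err_le_half n x : 0 <= x <= 2^-1 ->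
  `|x - pierce_s n x| <= 2^-1 ^+ n.
Proof.
elim: n x => [|n IH] x xh.
  by rewrite pierce_s0 subr0 expr0 ger0_norm; move: xh => /andP[? ?]; lra.
have x01 : 0 <= x <= 1 by move: xh => /andP[-> ?]; lra.
rewrite pierce_errS// normrM normrN (ger0_norm (dinv_ge0 _ x01)) exprS.
by rewrite ler_pM ?dinv_ge0// ?dinv_le_half// IH// pierce_T_itv.
Qed.

Lemma pierce_err_le n x : 0 <= x <= 1 -> `|x - pierce_s n.+1 x| <= 2^-1 ^+ n.
Proof.
move=> x01; rewrite pierce_errS// normrM normrN (ger0_norm (dinv_ge0 _ x01)).
rewrite -[leRHS]mul1r ler_pM ?dinv_ge0// ?dinv_le1//.
exact/pierce_err_le_half/pierce_T_itv.
Qed.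

Lemma cvg_error_psum x : 0 <= x <= 1 ->
  error_psum N x @[N --> \oo] --> pierce_error_sum x.
Proof.
move=> x01; suff : cvgn (error_psum ^~ x) by [].
have -> : error_psum ^~ x = series (fun n => x - pierce_s n.+1 x).
  by apply/funext => N; rewrite /error_psum big_add1.
apply: normed_cvg.
apply: (@series_le_cvg _ _ (geometric 1 2^-1)) => [n|n|n|].
- exact: normr_ge0.
- by rewrite /= mul1r exprn_ge0// invr_ge0.
- by rewrite /= mul1r; exact: pierce_err_le.
- by apply: is_cvg_geometric_series; rewrite ger0_norm; lra.
Qed.

(** The first error of x is - T x / d_1(x), and each later one is - 1/d_1(x)
    times an error of T x; summing gives the functional equation. *)
Lemma error_sumE x : 0 <= x <= 1 ->
  pierce_error_sum x =
  - dinv x * (pierce_T x + pierce_error_sum (pierce_T x)).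
Proof.
move=> x01; apply: norm_cvg_unique (cvg_error_psum _ x01) _ => /=.
rewrite -cvg_shiftS /=; under eq_fun do rewrite error_psumS//.
apply: cvgMl_tmp; apply: cvgD; first exact: cvg_cst.
exact/cvg_error_psum/pierce_T_itv1.
Qed.

Lemma error_sum_itv x : 0 <= x <= 1 -> - x <= pierce_error_sum x <= 0.
Proof.
move=> x01; have cv := cvg_error_psum _ x01.
have E N := andP (error_psum_itv N _ x01).
apply/andP; split.
- by apply: (limr_ge (cvgP _ cv)); near=> N; case: (E N).
- by apply: (limr_le (cvgP _ cv)); near=> N; case: (E N).
Unshelve. all: by end_near.
Qed.

(** * Clopen cylinders in the graph *)

(** Openness of {(x, E(x)) : x in A, 0 <= x <= 1} in the graph, phrased on the
    first coordinate so that sets can be pulled back along T. *)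
Definition graph_open (A : set R) : Prop :=
  exists2 U : set (R * R), open U &
    forall x, 0 <= x <= 1 -> A x <-> U (x, pierce_error_sum x).

Definition graph_clopen (A : set R) : Prop :=
  graph_open A /\ graph_open (~` A).

Lemma graph_openI A B : graph_open A -> graph_open B -> graph_open (A `&` B).
Proof.
move=> [U oU AU] [V oV BV]; exists (U `&` V); first exact: openI.
by move=> x x01; rewrite /setI/=; have := AU _ x01; have := BV _ x01; tauto.
Qed.

Lemma graph_openU A B : graph_open A -> graph_open B -> graph_open (A `|` B).
Proof.
move=> [U oU AU] [V oV BV]; exists (U `|` V); first exact: openU.
by move=> x x01; rewrite /setU/=; have := AU _ x01; have := BV _ x01; tauto.
Qed.

Lemma eq_graph_open A B : (forall x, 0 <= x <= 1 -> A x <-> B x) ->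
  graph_open A -> graph_open B.
Proof.
move=> AB [U oU AU]; exists U => // x x01.
by have := AB _ x01; have := AU _ x01; tauto.
Qed.

Lemma affine_continuous (a b c : R) :
  continuous (fun p : R * R => a + b * p.1 + c * p.2).
Proof.
move=> p; apply: cvgD; first apply: cvgD; first exact: cvg_cst.
- by apply: cvgMl_tmp; exact: cvg_fst.
- by apply: cvgMl_tmp; exact: cvg_snd.
Qed.

Lemma graph_open_affine (a b c : R) :
  graph_open [set x | 0 < a + b * x + c * pierce_error_sum x].
Proof.
exists ((fun p : R * R => a + b * p.1 + c * p.2) @^-1` [set t | 0 < t]) => //.
apply: open_comp; last exact: open_gt.
by move=> p _; exact: affine_continuous.
Qed.

(** The expansion of 1/k stops after one digit, so the functional equation
    leads to E(0), and E(0) = 0 by the bounds on E. *)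
Lemma error_sum_inv_nat k x : (0 < k)%N -> k%:R * x = 1 ->
  pierce_error_sum x = 0.
Proof.
move=> k0 kx; have x0 : 0 < x by rewrite -(@pmulr_rgt0 _ k%:R) ?kx ?ltr0n.
have k1 : (1 : R) <= k%:R by rewrite ler1n.
have x01 : 0 <= x <= 1 by apply/andP; split; nra.
have kk : k%:R * x <= 1 < k.+1%:R * x by rewrite -natr1 mulrDl kx; lra.
rewrite error_sumE// (pierce_TE k)// kx subrr add0r.
have /andP[] : - 0 <= pierce_error_sum (0 : R) <= 0.
  by apply: error_sum_itv; rewrite lexx ler01.
rewrite oppr0 => E0 E0'; have -> : pierce_error_sum (0 : R) = 0 by lra.
by rewrite mulr0.
Qed.

Lemma error_sum_on_digit j x : (0 < j)%N -> 0 <= x <= 1 ->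
  on_digit j x ->
  j%:R * pierce_error_sum x =
  - (1 - j%:R * x + pierce_error_sum (1 - j%:R * x)).
Proof.
move=> j0 x01 jx; rewrite error_sumE// (pierce_TE j)// (dinvE j)// mulrA mulrN.
by rewrite divff ?mulN1r// pnatr_eq0 -lt0n.
Qed.

(** With y = T x and k = j + 1 the claim is k (y + E(y)) >= 2 k y - 1.  The
    functional equation at y and E <= 0 give
    y + E(y) >= y - q T(y) = 2 y - q, where q = 1/d_1(y) <= 1/k because
    k y <= 1.  As x decreases to 1/k the right-hand side tends to -1, whereas
    E(1/k) = 0. *)
Lemma error_sum_jump j x : (0 < j)%N -> 0 <= x <= 1 ->
  on_digit j x ->
  j.+1%:R * (j%:R * pierce_error_sum x) <= 1 - 2 * j.+1%:R * (1 - j%:R * x).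
Proof.
move=> j0 x01 jx; rewrite error_sum_on_digit//.
have y01 : 0 <= 1 - j%:R * x <= 1.
  by rewrite -(pierce_TE j)//; exact: pierce_T_itv1.
set y := 1 - j%:R * x in y01 *.
have jy : j.+1%:R * y <= 1.
  have : (0 : R) <= j%:R by [].
  by move: jx => /andP[_]; rewrite /y -natr1; nra.
have Ty01 := pierce_T_itv1 _ y01.
rewrite [pierce_error_sum y]error_sumE//.
have := dinv_mul_le1 j.+1 _ y01 jy; have := dinv_ge0 _ y01.
have := mul_dinvT _ y01; have /andP[_] := error_sum_itv _ Ty01.
set q := dinv y; set E := pierce_error_sum _; set T := pierce_T y.
move=> E0 qT q0 kq.
have qE : 0 <= j.+1%:R * (q * - E) by rewrite !mulr_ge0// oppr_ge0.
have kqT : j.+1%:R * (q * T) = j.+1%:R * q - j.+1%:R * y by rewrite qT mulrBr.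
by lra.
Qed.

(** The complement is open already on the line.  The set itself is all of
    [0, 1] for k <= 1.  For k = j + 1 with j >= 1, the points with k x < 1
    form an open set, and around 1/k the points of the graph with k x > 1 are
    excluded by the open conditions j x < 1 and E(x) above the bound of
    the jump. *)
Lemma graph_clopen_le_inv k : graph_clopen [set x | k%:R * x <= 1].
Proof.
split; last first.
  apply: eq_graph_open (graph_open_affine (-1) k%:R 0) => x x01 /=.
  by rewrite mul0r addr0 addrC subr_gt0 ltNge; split=> /negP.
case: k => [|[|j]].
- apply: eq_graph_open (graph_open_affine 1 0 0) => x x01 /=.
  by rewrite !mul0r !addr0 ltr01 ler01.
- apply: eq_graph_open (graph_open_affine 1 0 0) => x /andP[_ x1] /=.
  by rewrite !mul0r !addr0 ltr01 mul1r x1.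
set k := j.+2%:R.
(* The last of the three conditions is the negation of the jump inequality. *)
apply: eq_graph_open (graph_openU _ _ (graph_open_affine 1 (- k) 0)
  (graph_openI _ _ (graph_open_affine 1 (- j.+1%:R) 0)
    (graph_open_affine (2 * k - 1) (- (2 * k * j.+1%:R)) (k * j.+1%:R)))).
move=> x x01 /=; have kE : k = j.+1%:R + 1 by rewrite natr1.
have j1 : (1 : R) <= j.+1%:R by rewrite ler1n.
rewrite /setU /setI /=; split => [[|[jx E0]]|].
- by lra.
- rewrite leNgt; apply/negP => kx.
  have jx1 : j.+1%:R * x <= 1 < j.+2%:R * x by rewrite kx andbT; lra.
  by have := error_sum_jump j.+1 x isT x01 jx1; rewrite -/k; lra.
- rewrite le_eqVlt => /predU1P[kx|kx]; last by left; lra.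
  right; rewrite (error_sum_inv_nat j.+2)//.
  have x0 : 0 < x by rewrite -(@pmulr_rgt0 _ k) ?kx ?ltr0n.
  have jx : j.+1%:R * x = 1 - x by move: kx; rewrite kE; lra.
  by split; nra.
Qed.

(** As 1 - j x = T x on the points of first digit j, the sequence w prescribes
    the first digits and k bounds the next digit from below.  That digit may be
    infinite, so that a point whose expansion stops after w has small cylinders
    around it too, those with large k. *)
Fixpoint cylinder k (w : seq nat) : set R :=
  if w is j :: w' then
    [set x | on_digit j x /\ cylinder k w' (1 - j%:R * x)]
  else [set x | k%:R * x <= 1].

Lemma on_digitP j x :
  on_digit j x <-> j%:R * x <= 1 /\ ~ (j.+1%:R * x <= 1).
Proof. by rewrite ltNge; split=> [/andP[-> /negP]|[-> /negP]]. Qed.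

Lemma digit_gt0 j x : x <= 1 -> 1 < j.+1%:R * x -> (0 < j)%N.
Proof. by case: j => // x1; rewrite mul1r ltNge x1. Qed.

(** On the points with first digit j, the map (x, E(x)) |-> (T x, E(T x)) is
    the restriction of a continuous, indeed affine, map of the plane. *)
Lemma graph_open_pullback j A : graph_open A ->
  graph_open [set x | on_digit j x /\ A (1 - j%:R * x)].
Proof.
move=> [U oU AU].
have [jo _] := graph_clopen_le_inv j.
have [_ jo'] := graph_clopen_le_inv j.+1.
have fo : graph_open [set x | U (1 - j%:R * x,
    -1 + j%:R * x - j%:R * pierce_error_sum x)].
  exists ((fun p : R * R => (1 + - j%:R * p.1 + 0 * p.2,
     -1 + j%:R * p.1 + - j%:R * p.2)) @^-1` U).
    apply: open_comp => // p _.
    exact: (cvg_pair (affine_continuous 1 (- j%:R) 0 p)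
      (affine_continuous (-1) j%:R (- j%:R) p)).
  by move=> x x01 /=; rewrite mul0r addr0 !mulNr.
apply: eq_graph_open (graph_openI _ _ (graph_openI _ _ jo jo') fo) => x x01.
rewrite /setI /setC /=.
have sw := on_digitP j x.
have key : on_digit j x ->
    (A (1 - j%:R * x) <->
     U (1 - j%:R * x, -1 + j%:R * x - j%:R * pierce_error_sum x)).
  move=> jx; have j0 : (0 < j)%N.
    by move: jx x01 => /andP[_ xj] /andP[_ x1]; exact: digit_gt0 x1 xj.
  have -> : -1 + j%:R * x - j%:R * pierce_error_sum x =
      pierce_error_sum (1 - j%:R * x).
    by rewrite error_sum_on_digit//; ring.
  by apply: AU; rewrite -(pierce_TE j)//; exact: pierce_T_itv1.
by split=> [[/sw jx /key]|[jx /key]]; tauto.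
Qed.

Lemma graph_clopen_cylinder k w : graph_clopen (cylinder k w).
Proof.
elim: w => [|j w [IH IHC]] /=; first exact: graph_clopen_le_inv.
split; first exact: graph_open_pullback.
have [_ jo] := graph_clopen_le_inv j.
have [jo' _] := graph_clopen_le_inv j.+1.
apply: eq_graph_open
  (graph_openU _ _ (graph_openU _ _ jo jo') (graph_open_pullback j _ IHC)).
move=> x _; rewrite /setU /setC /=.
have sw := on_digitP j x.
case: (pselect (j%:R * x <= 1)); case: (pselect (j.+1%:R * x <= 1)); tauto.
Qed.

(** * Cylinders shrink to points *)

(** Prefixing a digit j divides the difference in the first coordinate by j,
    but the difference in the second coordinate may become as large as the sum
    of both differences divided by j.  For j = 2 this estimate shrinks neither
    the maximum nor the sum of the differences by a fixed factor; weight 2 on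
    the first coordinate gives the factor 3/4. *)
Definition graph_dist x y : R :=
  2 * `|x - y| + `|pierce_error_sum x - pierce_error_sum y|.

(** With a and b the images of x and y, j |x - y| = |a - b| and
    j |E(x) - E(y)| <= |a - b| + |E(a) - E(b)|. *)
Lemma graph_dist_digit j x y : 0 <= x <= 1 -> 0 <= y <= 1 ->
  on_digit j x -> on_digit j y ->
  j%:R * graph_dist x y <= 3 / 2 * graph_dist (1 - j%:R * x) (1 - j%:R * y).
Proof.
move=> x01 y01 jx jy; have j0 : (0 < j)%N.
  by move: jx x01 => /andP[_ xj] /andP[_ x1]; exact: digit_gt0 x1 xj.
set a := 1 - j%:R * x; set b := 1 - j%:R * y.
have jE (t : R) : j%:R * `|t| = `|j%:R * t|.
  by rewrite normrM [`|j%:R|]ger0_norm.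
have -> : j%:R * graph_dist x y = 2 * `|a - b| +
    `|(a - b) + (pierce_error_sum a - pierce_error_sum b)|.
  rewrite /graph_dist mulrDr mulrCA !jE mulrBr -normrN; congr (2 * `|_| + _).
    by rewrite /a /b; ring.
  rewrite mulrBr !error_sum_on_digit// -normrN -/a -/b.
  by congr `|_|; ring.
have := ler_normD (a - b) (pierce_error_sum a - pierce_error_sum b).
have := normr_ge0 (pierce_error_sum a - pierce_error_sum b).
rewrite /graph_dist; lra.
Qed.

(** If the expansion stops at x = 0, a set {k y <= 1} with k large is small
    since |E(y)| <= y.  Otherwise x has first digit at least 2, and prefixing
    it to a cylinder around T x gains the factor (3/2) / 2 = 3/4. *)
Lemma small_cylinder_half n x : 0 <= x <= 2^-1 ->
  exists k w, cylinder k w x /\ forall y, 0 <= y <= 1 -> cylinder k w y ->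
    graph_dist x y <= 3 * (3 / 4) ^+ n.
Proof.
have itvE (t : R) : 0 <= t <= 1 -> - t <= pierce_error_sum t <= 0.
  exact: error_sum_itv.
elim: n x => [|n IH] x /andP[x0 x2].
  exists 0%N, [::]; split=> [|y /[dup] y01 /andP[y0 y1] _] /=.
    by rewrite mul0r.
  have x01 : 0 <= x <= 1 by lra.
  rewrite expr0 /graph_dist.
  have := itvE _ x01; have := itvE _ y01 => /andP[? ?] /andP[? ?].
  have : `|x - y| <= 1 by rewrite ler_norml; lra.
  have : `|pierce_error_sum x - pierce_error_sum y| <= 1.
    by rewrite ler_norml; lra.
  by lra.
move: x0; rewrite le_eqVlt => /predU1P[<-|x0].
  pose t : R := (3 / 4) ^+ n.+1; have t0 : 0 < t by rewrite exprn_gt0.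
  have [k tk] : exists k, t^-1 <= k%:R.
    have tV0 : 0 <= t^-1 by rewrite invr_ge0 ltW.
    have /andP[_ /ltW ?] := truncn_itv tV0.
    by exists (Num.truncn t^-1).+1.
  exists k, [::]; split=> [|y /[dup] y01 /andP[y0 y1] /= ky].
    by rewrite /= mulr0.
  have yt : y <= t.
    rewrite -(@ler_pM2l _ t^-1) ?invr_gt0// mulVf ?gt_eqF//.
    by apply: le_trans ky; rewrite ler_wpM2r.
  rewrite /graph_dist.
  have := itvE _ y01; have := itvE 0 _; rewrite lexx ler01 => /(_ isT).
  move=> /andP[? ?] /andP[? ?].
  have : `|0 - y| <= y by rewrite ler_norml; lra.
  have : `|pierce_error_sum 0 - pierce_error_sum y| <= y.
    by rewrite ler_norml; lra.
  by rewrite -/t; lra.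
have x01 : 0 <= x <= 1 by apply/andP; split; lra.
have [j j0 jx] : exists2 j, (0 < j)%N & on_digit j x.
  by apply: digit_exists; rewrite x0; case/andP: x01.
have j2 : (2 : R) <= j%:R.
  rewrite (ler_nat R 2 j) -ltnS -(ltr_nat R).
  rewrite -(ltr_pM2r x0); move: jx => /andP[_]; lra.
have := pierce_T_itv _ x01; rewrite (pierce_TE j)// => /IH [k [w [wx wP]]].
exists k, (j :: w); split=> // y y01 /= [jy wy].
have Ty : 0 <= 1 - j%:R * y <= 1.
  by rewrite -(pierce_TE j)//; exact: pierce_T_itv1.
have := wP _ Ty wy; have := graph_dist_digit _ _ _ x01 y01 jx jy.
have : 0 <= graph_dist x y by rewrite addr_ge0// mulr_ge0.
by rewrite exprS; nra.
Qed.

(** Only the points above 1/2 have first digit 1; this one digit costs the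
    factor 3/2 at most. *)
Lemma small_cylinder (e : R) x : 0 < e -> 0 <= x <= 1 ->
  exists k w, cylinder k w x /\ forall y, 0 <= y <= 1 -> cylinder k w y ->
    graph_dist x y < e.
Proof.
move=> e0 x01.
have [n en] : exists n, 3 / 2 * (3 * (3 / 4) ^+ n) < e.
  have : (3 / 2 * 3) * (3 / 4) ^+ n @[n --> \oo] --> (3 / 2 * 3 * 0 : R).
    by apply: cvgMl_tmp; apply: cvg_expr; rewrite ger0_norm; lra.
  rewrite mulr0 => /cvgr_lt /(_ _ e0) [N _ /(_ N (leqnn N))] /=.
  by rewrite -mulrA; exists N.
case: (leP x 2^-1) => x2.
  have [|k [w [wx wP]]] := small_cylinder_half n x.
    by rewrite x2 andbT; case/andP: x01.
  exists k, w; split=> // y y01 wy; apply: le_lt_trans en.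
  have : 0 <= graph_dist x y by rewrite addr_ge0// mulr_ge0.
  by have := wP _ y01 wy; lra.
have x1 : 1%:R * x <= 1 < 2%:R * x by apply/andP; split; lra.
have := pierce_T_itv _ x01; rewrite (pierce_TE 1)//.
move=> /(small_cylinder_half n)[k [w [wx wP]]].
exists k, (1%N :: w); split=> // y y01 /= [jy wy].
have Ty : 0 <= 1 - 1%:R * y <= 1.
  by rewrite -(pierce_TE 1)//; exact: pierce_T_itv1.
have := wP _ Ty wy; have := graph_dist_digit _ _ _ x01 y01 x1 jy.
by rewrite mul1r => ? ?; apply: le_lt_trans en; lra.
Qed.

End PierceErrorSum.

(** * Spaces with a countable clopen base *)

Section ZeroDimensional.
Local Open Scope classical_set_scope.

(** The index of the first basic set that contains x and lies in a member of
    the cover is a locally constant function of x because all basic sets are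
    clopen. *)
Lemma countable_clopen_base_covering_dim_le0 (X : topologicalType)
    (I : countType) (B : I -> set X) :
  (forall i, open (B i)) -> (forall i, open (~` B i)) ->
  (forall (x : X) (U : set X), open U -> U x ->
    exists2 i, B i x & B i `<=` U) ->
  covering_dim_le X 0.
Proof.
move=> oB oBC baseB C [finC oC covC].
pose good n (i : I) (U : set X) := [/\ pickle i = n, C U & B i `<=` U].
pose hits n x := exists i U, good n i U /\ B i x.
have hit x : exists n, `[< hits n x >].
  have [U CU Ux] : (\bigcup_(U in C) U) x by rewrite covC.
  have [i Bix BiU] := baseB _ _ (oC _ CU) Ux.
  by exists (pickle i); apply/asboolP; exists i, U.
pose first x := ex_minn (hit x).
have hits_first x : hits (first x) x.
  by rewrite /first; case: ex_minnP => n /asboolP.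
have first_min x m : hits m x -> (first x <= m)%N.
  by rewrite /first; case: ex_minnP => n _ H Hm; apply: H; apply/asboolP.
(* Where no basic set of index n is usable, hits n is empty and any value
   would do. *)
have good_choice n : exists U : set X,
    forall x, hits n x -> C U /\ (forall y, hits n y -> U y).
  case: (pselect (exists i U, good n i U)) => [[i [U [e CU iU]]]|nog].
    exists U => x _; split=> // y [j [V [[e' _ _] jy]]]; apply: iU.
    by have -> : i = j by apply: (pcan_inj (@pickleK I)); rewrite e e'.
  by exists setT => x [i [U [gi _]]]; case: nog; exists i, U.
have [F FP] := choice good_choice.
have ohits n : open [set x | hits n x].
  rewrite openE => x [i [U [gi ix]]]; apply: (filterS (P := B i)).
    by move=> y iy; exists i, U.
  exact: open_nbhs_nbhs.
have ohitsC n : open [set x | ~ hits n x].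
  case: (pselect (exists i U, good n i U)) => [[i [U gi]]|nog].
    rewrite (_ : mkset _ = ~` B i)//; apply/seteqP; split=> x /=.
      by move=> nh ix; apply: nh; exists i, U.
    move=> nix [j [V [[e' _ _] jx]]]; apply: nix; case: gi => e _ _.
    by have -> : i = j by apply: (pcan_inj (@pickleK I)); rewrite e e'.
  rewrite (_ : mkset _ = setT); first exact: openT.
  apply/seteqP; split=> x //= _ [i [U [gi _]]]; apply: nog; by exists i, U.
have obefore n : open [set x | forall m, (m < n)%N -> ~ hits m x].
  elim: n => [|n IH].
    rewrite (_ : mkset _ = setT); first exact: openT.
    by apply/seteqP; split.
  rewrite (_ : mkset _ =
      [set x | forall m, (m < n)%N -> ~ hits m x] `&` [set x | ~ hits n x]).
    exact: openI.
  apply/seteqP; split=> x /= => [H|[H hn] m].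
    by split=> [m mn|]; apply: H => //; exact: ltnW.
  by rewrite ltnS leq_eqVlt => /predU1P[->//|]; exact: H.
have ofirst n : open [set x | first x = n].
  rewrite (_ : mkset _ = [set x | hits n x] `&`
      [set x | forall m, (m < n)%N -> ~ hits m x]).
    exact: openI.
  apply/seteqP; split=> x /=.
    move=> <-; split; first exact: hits_first.
    by move=> m /= mf /first_min; rewrite leqNgt mf.
  move=> [hn Hlt]; apply/eqP; rewrite eqn_leq first_min//= leqNgt.
  by apply/negP => /Hlt; apply; exact: hits_first.
(* The pieces assigned to the same member of the cover are merged, so that
   the refinement is finite. *)
pose W U : set X := [set x | F (first x) = U].
exists (W @` C); split; first split.
- exact: finite_image.
- move=> _ [U CU <-].
  rewrite (_ : W U = \bigcup_(n in [set n | F n = U]) [set x | first x = n]).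
    by apply: bigcup_open => n _.
  apply/seteqP; split=> x /=; first by move=> Wx; exists (first x).
  by move=> [n /= Fn fx]; rewrite /W /= fx.
- apply/seteqP; split=> // x _; exists (W (F (first x))); last by [].
  by exists (F (first x)) => //; have [] := FP _ _ (hits_first x).
- move=> _ [U CU <-]; exists U => // x <-.
  by have [_] := FP _ _ (hits_first x); apply; exact: hits_first.
- move=> x; apply: (@card_le_trans _ _ _ [set W (F (first x))]).
    by apply: subset_card_le => _ [[U CU <-]] ->.
  by rewrite (card_le_eql card_set1).
Qed.

End ZeroDimensional.

(** * The dimension of the graph *)

Section Graph.
Import Order.TTheory GRing.Theory Num.Theory.
Local Open Scope classical_set_scope.
Local Open Scope ring_scope.
Context {R : realType}.
Local Notation graph := (set_type (pierce_error_sum_graph R)).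

Lemma graph_pointP (p : graph) :
  0 <= (\val p).1 <= 1 /\ \val p = ((\val p).1, pierce_error_sum (\val p).1).
Proof.
have [x] : pierce_error_sum_graph R (\val p) by exact: set_mem (valP p).
by rewrite /= in_itv /= => x01 <-.
Qed.

Lemma open_graph_preimage (A : set R) : graph_open A ->
  open [set p : graph | A (\val p).1].
Proof.
move=> [U oU AU]; exists U => //; apply/seteqP.
split=> p /=; have [p01 pE] := graph_pointP p; rewrite ?set_valE pE /=.
- exact: (AU _ p01).2.
- exact: (AU _ p01).1.
Qed.

Lemma cylinder_base (p : graph) (U : set graph) : open U -> U p ->
  exists2 kw : nat * seq nat, cylinder kw.1 kw.2 (\val p).1 &
    [set q : graph | cylinder kw.1 kw.2 (\val q).1] `<=` U.
Proof.
move=> [V oV <-] /= Vp.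
have [p01 pE] := graph_pointP p.
have /nbhs_ballP[e /= e0 eV] : nbhs (\val p) V by exact: open_nbhs_nbhs.
have [k [w [pw wP]]] := small_cylinder e _ e0 p01.
exists (k, w) => // q /= qw; apply: eV.
have [q01 qE] := graph_pointP q.
suff : ball (\val p) e (\val q) by [].
rewrite pE qE; move: (wP _ q01 qw); move: (\val p).1 (\val q).1 => x y.
rewrite /graph_dist => xy; have := normr_ge0 (x - y).
have := normr_ge0 (pierce_error_sum x - pierce_error_sum y) => ? ?.
by split; rewrite /ball /= /ball_ /=; lra.
Qed.

End Graph.

Theorem theorem4p12 (R : realType) :
  covering_dim (set_type (pierce_error_sum_graph R)) = (0%N)%:E.
Proof.
have dim0 : covering_dim_le (set_type (pierce_error_sum_graph R)) 0.
  apply: (@countable_clopen_base_covering_dim_le0 _ (nat * seq nat)%type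
    (fun kw => [set p : set_type (pierce_error_sum_graph R) |
      cylinder kw.1 kw.2 (\val p).1]%classic)) => [[k w]|[k w]|p U oU Up].
  - exact: (open_graph_preimage _ (graph_clopen_cylinder k w).1).
  - exact: (open_graph_preimage _ (graph_clopen_cylinder k w).2).
  - exact: cylinder_base.
rewrite /covering_dim; case: pselect => [ex_m|[]]; last first.
  by exists 0%N; apply/asboolP.
case: ex_minnP => m _ /(_ 0%N); rewrite leqn0 => m0.
by congr (_%:E); apply/eqP/m0/asboolP.
Qed.
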